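(* Let $(R,\mathfrak{m})$ be a finite commutative local ring with identity, which is not a field, with residue field $\mathbb{F}_q$ of prime characteristic $p$. Let $k\in\mathbb{N}$ with $(k,p)=1$ be such that $k\mid q-1$ and $\frac{q-1}{k}\dagger q-1$. If $2\le k\le\sqrt[4]{q}+1$, then $$g_R(k)=\begin{cases}2, & \text{if } q \text{ is even, or else } q \text{ is odd and } k\mid\tfrac{q-1}{2},\\ 3, & \text{if } q \text{ is odd and } k\nmid\tfrac{q-1}{2}.\end{cases}$$ In particular (case $k=2$), $g_R(2)=2$ if $q\equiv1\pmod 4$ and $g_R(2)=3$ if $q\equiv3\pmod 4$. Furthermore (case $k=2^r$), $g_R(2^r)=2$ if $q\equiv1\pmod{2^{r+1}}$ and $g_R(2^r)=3$ if $q\not\equiv1\pmod{2^{r+1}}$, for every $q\ge2^{4r}$ with $r\ge2$.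
   Context: The Waring number $g_R(k)$ is the minimum $s\in\mathbb{N}$, if it exists, such that $x_1^k+\cdots+x_s^k=r_0$ has a solution in $R$ for every $r_0\in R$. $(a,b)$ denotes the greatest common divisor. For $q=p^m$, $n\dagger q-1$ means that $n\mid p^m-1$ and $n\nmid p^a-1$ for all $1\le a<m$. The assertions for $k=2$ and $k=2^r$ are made under the same standing hypotheses on $k$ (coprime with $p$, so $q$ is odd, and dividing $q-1$). *)

(* Defs.v *)
From HB Require Import structures.
From mathcomp Require Import all_boot all_order all_algebra all_field.
Set Implicit Arguments.
Unset Strict Implicit.
Unset Printing Implicit Defensive.
Import GRing.Theory Num.Theory.
Local Open Scope ring_scope.

Definition is_field_ring (R : comNzRingType) : Prop :=
  forall x : R, x != 0 -> exists y : R, x * y = 1.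

(* [idealr R] is the type of proper decidable ideals of [R]; for finite [R]
   decidability is no restriction. *)
Definition maximal_ideal (R : finComNzRingType) (m : idealr R) : Prop :=
  forall J : idealr R, {subset m <= J} -> J =i m.

Definition local_ring (R : finComNzRingType) (m : idealr R) : Prop :=
  maximal_ideal m /\ forall J : idealr R, maximal_ideal J -> J =i m.

Definition sums_of_powers_cover (R : comNzRingType) (k s : nat) : Prop :=
  forall r : R, exists x : {ffun 'I_s -> R}, \sum_(i < s) x i ^+ k = r.

(* [waring R k g] means that the Waring number g_R(k) exists and equals [g]. *)
Definition waring (R : comNzRingType) (k g : nat) : Prop :=
  sums_of_powers_cover R k g /\
  forall s : nat, sums_of_powers_cover R k s -> (g <= s)%N.

(* The relation n † p^m - 1. *)
Definition dagger (n p m : nat) : Prop :=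
  (n %| p ^ m - 1)%N /\
  forall a : nat, (1 <= a < m)%N -> ~ (n %| p ^ a - 1)%N.

(* Main.v *)
Require Import Defs.
From HB Require Import structures.
From mathcomp Require Import all_boot all_order all_algebra all_solvable all_field.
From mathcomp Require Import ring.
Set Implicit Arguments.
Unset Strict Implicit.
Unset Printing Implicit Defensive.
Import Order.TTheory GRing.Theory Num.Theory.

(** Write [f : R -> F] for the reduction map, [M] for its kernel, which is the
    maximal ideal, and [q] for the cardinal of [F].

    Over [F], every nonzero [b] is a sum of two k-th powers as soon as
    [(k - 1)^4 <= q].  Let [chi] be a multiplicative character of order [k];
    then [\sum_(i < k) chi u ^+ i] vanishes unless [u] is a k-th power, so it
    is enough to see that
      [\sum_u (\sum_i chi u ^+ i) * (\sum_j chi (b - u) ^+ j)]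
    is nonzero.  Expanding it gives [q] plus [(k - 1)^2] Jacobi sums with
    unimodular coefficients; [k - 1] of them have modulus [1] and the others
    have modulus [sqrt q].  Since [(k - 1) * (1 + (k - 2) * sqrt q) < q] under
    the hypothesis on [k], even when [(k - 1)^4 = q], the sum is nonzero
    ([sum_two_powers]).  The modulus of a Jacobi sum is computed
    directly, without additive characters, by a homographic change of variable
    ([sum_mul_char_mobius], [jacobi_norm]).

    From [F] to [R]: as [k] is invertible in [F], a lift of the k-th power of a
    nonzero element is a k-th power in [R] ([hensel_power]).  Hence every unit
    of [R] is a sum of two k-th powers.  An element [r] of [M] is one too when
    [-1] is a k-th power in [F], because [r - 1] reduces to [-1]; in general
    [r] is the sum of [1] and of the unit [r - 1], so three powers suffice.

    Lower bounds: [M] strictly contains an ideal [A] that contains all products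
    of two elements of [M] ([exists_irreducible_nonunit]).  If [r] is in [M]
    but not in [A], it is not a k-th power, and if it is a sum of two k-th
    powers, their bases are units, so [-1] is a k-th power in [F].  Finally
    [-1] is a k-th power in [F] if and only if [q] is even or [k] divides
    [(q - 1) / 2] ([neg1_power]).  The cases [k = 2] and [k = 2 ^ r] only
    translate the last condition into a congruence. *)

Local Open Scope ring_scope.

(** * Multiplicative characters and Jacobi sums of a finite field *)

(** Characters are extended by [chi 0 = 0].  The trivial character is therefore
    left out of the theory: below it is [fun x => chi x ^+ 0], with value [1]
    at [0], which is the convention that makes counting formulas uniform. *)
Definition mul_char (F : finFieldType) (chi : F -> algC) : Prop :=
  [/\ chi 0 = 0, chi 1 = 1 & {morph chi : x y / x * y}].

Definition nontrivial (F : finFieldType) (chi : F -> algC) : Prop :=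
  exists2 x, x != 0 & chi x != 1.

Definition jacobi (F : finFieldType) (chi psi : F -> algC) : algC :=
  \sum_x chi x * psi (1 - x).

Lemma mul_charX (F : finFieldType) (chi : F -> algC) (n : nat) :
  mul_char chi -> (0 < n)%N -> mul_char (fun x => chi x ^+ n).
Proof.
case=> chi0 chi1 chiM n_gt0; split; first by rewrite chi0 expr0n eqn0Ngt n_gt0.
  by rewrite chi1 expr1n.
by move=> x y; rewrite chiM exprMn.
Qed.

Lemma mul_char_exp (F : finFieldType) (chi : F -> algC) x n :
  mul_char chi -> chi (x ^+ n) = chi x ^+ n.
Proof.
by case=> _ chi1 chiM; elim: n => [|n IHn]; rewrite ?expr0 // !exprS chiM IHn.
Qed.

Lemma fin_expf_card_pred (F : finFieldType) (x : F) :
  x != 0 -> x ^+ (#|F| - 1) = 1.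
Proof.
move=> x0; apply: (mulfI x0); rewrite -exprS subn1 prednK ?expf_card ?mulr1 //.
exact: ltnW (finNzRing_gt1 F).
Qed.

Lemma mul_char_norm (F : finFieldType) (chi : F -> algC) x :
  mul_char chi -> x != 0 -> `|chi x| = 1.
Proof.
move=> chiP x0; apply/eqP.
have n0 : (0 < #|F| - 1)%N by rewrite subn_gt0 finNzRing_gt1.
rewrite -(pexpr_eq1 n0) // -normrX -mul_char_exp // fin_expf_card_pred //.
by case: chiP => _ -> _; rewrite normr1.
Qed.

Lemma mul_char_conj (F : finFieldType) (chi : F -> algC) x :
  mul_char chi -> (chi x)^* = chi x^-1.
Proof.
move=> chiP; case: (chiP) => chi0 chi1 chiM.
have [->|x0] := eqVneq x 0; first by rewrite invr0 chi0 conjC0.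
have nx := mul_char_norm chiP x0.
have cx0 : chi x != 0 by rewrite -normr_gt0 nx ltr01.
by apply: (mulfI cx0); rewrite -normCK nx expr1n -chiM divff.
Qed.

Lemma sum_mul_char (F : finFieldType) (chi : F -> algC) :
  mul_char chi -> nontrivial chi -> \sum_x chi x = 0.
Proof.
case=> _ _ chiM [a a0 chia]; apply/eqP.
have inj : injective (fun x => a * x) by exact: mulfI.
have : chi a * \sum_x chi x = \sum_x chi x.
  by rewrite [RHS](reindex_inj inj) mulr_sumr; apply: eq_bigr => x _; rewrite chiM.
move/eqP; rewrite -subr_eq0 -{2}[\sum_x _]mul1r -mulrBl mulf_eq0 subr_eq0.
by rewrite (negPf chia).
Qed.

(** The substitution [u = (1 - y)^-1] turns the fraction into the affine
    expression [(c + d) * u - d], except at [y = 1], that is [u = 0], where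
    division by zero makes the term on the left vanish.  The full sum over an
    affine line is zero, so only the missing value at [u = 0] remains. *)
Lemma sum_mul_char_mobius (F : finFieldType) (chi : F -> algC) (c d : F) :
  mul_char chi -> nontrivial chi -> c + d != 0 ->
  \sum_y chi ((c + d * y) / (1 - y)) = - chi (- d).
Proof.
move=> chiP chiN cd0; have [chi0 _ _] := chiP.
have inj1 : injective (fun u : F => 1 - u^-1).
  by move=> u v /addrI /oppr_inj /invr_inj.
(* [y = 1 - u^-1]; the term [u = 0] is [y = 1] because [0^-1 = 0]. *)
rewrite (reindex_inj inj1) (bigD1 0) //= invr0 subr0 subrr invr0 mulr0 chi0 add0r.
have inj2 : injective (fun u : F => (c + d) * u - d).
  by move=> u v /addIr /(mulfI cd0).
have := sum_mul_char chiP chiN.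
rewrite (reindex_inj inj2) (bigD1 0) //= mulr0 add0r => /eqP.
rewrite addr_eq0 => /eqP ->; rewrite opprK; apply: eq_bigr => u u0.
congr (chi _); field.
by rewrite u0 opprB addrC subrK oner_eq0.
Qed.

(** Expand the squared modulus as a double sum over [x] and [y] and put
    [x = a * y].  The inner sum over [y] is homographic and equals
    [- psi a - 1], with an additional [q] when [a = 1]; summing against [chi],
    orthogonality kills everything except that [q]. *)
Lemma jacobi_norm (F : finFieldType) (chi psi : F -> algC) :
  mul_char chi -> mul_char psi -> nontrivial chi -> nontrivial psi ->
  nontrivial (fun x => chi x * psi x) ->
  `|jacobi chi psi| ^+ 2 = #|F|%:R.
Proof.
move=> chiP psiP chiN psiN chipsiN.
have [chi0 chi1 chiM] := chiP; have [psi0 psi1 psiM] := psiP.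
have chipsiP : mul_char (fun x => chi x * psi x).
  split; first by rewrite chi0 mul0r.
    by rewrite chi1 psi1 mulr1.
  by move=> x y; rewrite chiM psiM mulrACA.
pose I a := \sum_(y | y != 0) psi ((1 - a * y) / (1 - y)).
have normJ : `|jacobi chi psi| ^+ 2 = \sum_a chi a * I a.
  rewrite normCK /jacobi rmorph_sum mulr_sumr (bigD1 0) //=.
  rewrite chi0 mul0r conjC0 mulr0 add0r.
  under [RHS]eq_bigr do rewrite /I mulr_sumr.
  rewrite exchange_big /=; apply: eq_bigr => y y0.
  rewrite mulr_suml (reindex_inj (mulIf y0)) /=; apply: eq_bigr => a _.
  rewrite rmorphM /= chiM (mul_char_conj (1 - y)) // psiM.
  have := normCK (chi y); rewrite (mul_char_norm chiP y0) expr1n.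
  set a1 := chi a; set c1 := chi y => h.
  by rewrite [RHS]mulrA -[a1 * psi _]mulr1 h; ring.
have IE a : I a = - psi a - 1 + (a == 1)%:R * #|F|%:R.
  have [->|a1] := eqVneq a 1.
    have : \sum_(y : F) psi ((1 - 1 * y) / (1 - y)) = #|F|%:R - 1.
      rewrite (bigD1 1) //= mulr1 subrr mul0r psi0 add0r.
      rewrite (eq_bigr (fun=> 1)) => [|y y1]; last first.
        by rewrite mul1r divff ?psi1 // subr_eq0 eq_sym.
      rewrite sumr_const cardC1 -subn1 natrB //.
      exact: ltnW (finNzRing_gt1 F).
    rewrite (bigD1 0) //= -/(I 1) mulr0 subr0 divr1 psi1 => h.
    by apply: (addrI 1); rewrite h mul1r; ring.
  have a10 : 1 - a != 0 by rewrite subr_eq0 eq_sym.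
  have := sum_mul_char_mobius psiP psiN a10; rewrite opprK => h.
  rewrite mul0r addr0; apply: (addrI 1); rewrite addrCA subrr addr0 -h.
  rewrite [RHS](bigD1 0) //= mulr0 addr0 subr0 divr1 psi1; congr (_ + _).
  by apply: eq_bigr => y _; rewrite mulNr.
rewrite normJ.
have -> : \sum_a chi a * I a
  = - (\sum_a chi a * psi a) - \sum_a chi a + \sum_a chi a * ((a == 1)%:R * #|F|%:R).
  rewrite -!sumrN -!big_split; apply: eq_bigr => a _ /=.
  by rewrite IE !mulrDr !mulrN mulr1.
rewrite (sum_mul_char chipsiP) // (sum_mul_char chiP) // subr0 oppr0 add0r.
rewrite (bigD1 1) //= eqxx chi1 !mul1r.
by rewrite big1 ?addr0 // => a /negPf ->; rewrite mul0r mulr0.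
Qed.

(** The degenerate Jacobi sum, of a character and its inverse: here too the
    homographic substitution leaves a single term. *)
Lemma jacobi_conj (F : finFieldType) (chi : F -> algC) :
  mul_char chi -> nontrivial chi ->
  jacobi chi (fun x => (chi x)^*) = - chi (-1).
Proof.
move=> chiP chiN; have [_ _ chiM] := chiP.
have h0 : 0 + 1 != 0 :> F by rewrite add0r oner_eq0.
rewrite -(sum_mul_char_mobius chiP chiN h0); apply: eq_bigr => y _.
by rewrite mul_char_conj // -chiM add0r mul1r.
Qed.

Lemma finField_prim_root (F : finFieldType) :
  exists z : F, (#|F| - 1).-primitive_root z.
Proof.
have n0 : (0 < #|F| - 1)%N by rewrite subn_gt0 finNzRing_gt1.
have /hasP[z _ zP] : has (#|F| - 1).-primitive_root (enum [pred x : F | x != 0]).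
  apply: has_prim_root => //.
  - apply/allP => x; rewrite mem_enum inE => x0.
    by apply/unity_rootP; exact: fin_expf_card_pred.
  - exact: enum_uniq.
  - by rewrite -cardE subn1 -(cardC1 (0 : F)) subset_leq_card //; apply/subsetP.
by exists z.
Qed.

(** Sending a generator of the multiplicative group of [F] to a primitive k-th
    root of unity defines a character whose kernel is the group of nonzero
    k-th powers. *)
Lemma mul_char_of_order (F : finFieldType) (k : nat) :
  (k %| #|F| - 1)%N ->
  exists2 chi : F -> algC, mul_char chi &
    [/\ forall j, (0 < j < k)%N -> nontrivial (fun x => chi x ^+ j),
        forall x, x != 0 -> chi x ^+ k = 1
      & forall x, x != 0 -> chi x = 1 -> exists y, y ^+ k = x].
Proof.
move=> kn; set n := (_ - 1)%N in kn.
have n0 : (0 < n)%N by rewrite subn_gt0 finNzRing_gt1.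
have k0 : (0 < k)%N by apply: dvdn_gt0 kn.
have [z zP] := finField_prim_root F; have [w wP] := C_prim_root_exists k0.
have logP (x : F) : x != 0 -> exists i : nat, x == z ^+ i.
  by move=> /fin_expf_card_pred /(prim_rootP zP)[i ->]; exists i.
pose chi x := match eqVneq x 0 with
  | EqNotNeq _ => 0
  | NeqNotEq x0 => w ^+ (xchoose (logP x x0)) end.
have z0 : z != 0.
  apply/eqP => z0; have /eqP := prim_expr_order zP.
  by rewrite z0 expr0n eqn0Ngt n0 eq_sym oner_eq0.
have chi0 : chi 0 = 0 by rewrite /chi; case: eqVneq => [//|zz]; case/eqP: (zz).
have chiz i : chi (z ^+ i) = w ^+ i.
  rewrite /chi; case: eqVneq => [/eqP|zi0].
    by rewrite expf_eq0 (negPf z0) andbF.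
  have := xchooseP (logP _ zi0); rewrite (eq_prim_root_expr zP) => /eqP h.
  by apply/eqP; rewrite (eq_prim_root_expr wP) -(modn_dvdm _ kn) -h modn_dvdm.
exists chi.
  split=> //; first by rewrite -(expr0 z) chiz.
  move=> x y; have [->|/logP[i /eqP->]] := eqVneq x 0.
    by rewrite !mul0r chi0 mul0r.
  have [->|/logP[j /eqP->]] := eqVneq y 0; first by rewrite !mulr0 chi0 mulr0.
  by rewrite -exprD !chiz exprD.
split=> [j /andP[j0 jk]|x /logP[i /eqP->]|x /logP[i /eqP->]].
- exists z => //; rewrite -[z]expr1 chiz expr1 -(prim_order_dvd wP).
  by rewrite gtnNdvd.
- by rewrite chiz exprAC (prim_expr_order wP) expr1n.
- rewrite chiz => /eqP; rewrite -(prim_order_dvd wP) => ki.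
  by exists (z ^+ (i %/ k)); rewrite -exprM divnK.
Qed.

(** Both kinds of Jacobi sums occur among powers of a character of order [k]:
    the exponents are opposite modulo [k] exactly when [i + j = k]. *)
Lemma norm_jacobi (F : finFieldType) (chi : F -> algC) (k i j : nat) :
  mul_char chi ->
  (forall j, (0 < j < k)%N -> nontrivial (fun x => chi x ^+ j)) ->
  (forall x, x != 0 -> chi x ^+ k = 1) ->
  (0 < i < k)%N -> (0 < j < k)%N ->
  `|jacobi (fun x => chi x ^+ i) (fun x => chi x ^+ j)|
    = if (i + j == k)%N then 1 else sqrtC #|F|%:R.
Proof.
move=> chiP chiN chik ik jk; have [chi0 chi1 chiM] := chiP.
have [/andP[i0 ltik] /andP[j0 ltjk]] := (ik, jk).
have chiiP := mul_charX chiP i0; have chijP := mul_charX chiP j0.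
have [ijk|ijk] := eqVneq (i + j)%N k.
  rewrite -(mul_char_norm chiiP (x := -1)) ?oppr_eq0 ?oner_eq0 //.
  rewrite -[RHS]normrN -(jacobi_conj chiiP (chiN _ ik)); congr (`|_|).
  apply: eq_bigr => x _; congr (_ * _).
  have [->|x1] := eqVneq (1 - x) 0.
    by rewrite chi0 !expr0n !eqn0Ngt i0 j0 conjC0.
  have c0 : chi (1 - x) ^+ i != 0.
    by rewrite -normr_gt0 (mul_char_norm chiiP) // ltr01.
  apply: (mulfI c0); rewrite -exprD ijk chik // -normCK.
  by rewrite (mul_char_norm chiiP) // expr1n.
have prodN : nontrivial (fun x => chi x ^+ i * chi x ^+ j).
  have [ltk|gtk] : (i + j < k)%N \/ (k < i + j)%N.
    by apply/orP; rewrite -neq_ltn.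
    have [|x x0 xN] := chiN (i + j)%N; first by rewrite addn_gt0 i0.
    by exists x => //; rewrite -exprD.
  have [|x x0 xN] := chiN (i + j - k)%N.
    rewrite subn_gt0 gtk ltn_subLR; last exact: ltnW.
    by rewrite -addnS leq_add // ltnW.
  by exists x => //; rewrite -exprD -(subnK (ltnW gtk)) exprD chik ?mulr1.
apply: (pexpIrn (n := 2)) => //; rewrite ?nnegrE ?sqrtC_ge0 ?ler0n ?normr_ge0 //.
by rewrite sqrtCK (jacobi_norm chiiP chijP) //; apply: chiN.
Qed.

(** With [s = sqrt q] and [t ^ 2 <= s], the left-hand side is
    [t ^ 2 * s - t * (s - 1)], strictly less than [s ^ 2] because the factor
    multiplying [t * s] is [t - 1] and not [t].  This strict gain covers the extreme case
    [t ^ 4 = q], for instance [k = 3] and [q = 16]. *)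
Lemma jacobi_bound_lt (t q : nat) :
  (1 < q)%N -> (t ^ 4 <= q)%N ->
  t%:R * (1 + t.-1%:R * sqrtC q%:R) < q%:R :> algC.
Proof.
move=> q1 tq; set s : algC := sqrtC q%:R.
have ss : q%:R = s * s :> algC by rewrite -expr2 sqrtCK.
have s0 : 0 <= s by rewrite sqrtC_ge0 ler0n.
have s1 : 1 < s by rewrite -[1]sqrtC1 ltr_sqrtC ?nnegrE ?ler01 ?ler0n ?ltr1n.
have ts : t%:R * t%:R <= s.
  rewrite -(ler_pXn2r (n := 2)) ?nnegrE ?mulr_ge0 ?ler0n // sqrtCK -natrM -natrX.
  by rewrite ler_nat mulnn -expnM.
case: t {tq} ts => [|t] ts; first by rewrite mul0r ltr0n ltnW.
have -> : t.+1%:R * (1 + t.+1.-1%:R * s) = t.+1%:R * t.+1%:R * s - t.+1%:R * (s - 1).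
  by rewrite /= -[in t.+1%:R]addn1 natrD; ring.
rewrite ss; apply: (@lt_le_trans _ _ (t.+1%:R * t.+1%:R * s)).
  by rewrite ltrBlDr ltrDl mulr_gt0 ?ltr0n ?subr_gt0.
by rewrite ler_wpM2r.
Qed.

(** * Sums of two powers in a finite field *)

(** The double sum over [u] and pairs of exponents is [q] (both exponents
    zero), plus zero (exactly one exponent zero), plus Jacobi sums whose total
    modulus is less than [q]. *)
Lemma sum_two_powers (F : finFieldType) (k : nat) (b : F) :
  (0 < k)%N -> (k %| #|F| - 1)%N -> (k.-1 ^ 4 <= #|F|)%N -> b != 0 ->
  exists x y : F, x ^+ k + y ^+ k = b.
Proof.
move=> k0 kq; case: k k0 kq => [//|t] _ kq tq b0.
have [chi chiP [chiN chik chiK]] := mul_char_of_order kq.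
have [chi0 chi1 chiM] := chiP.
(* [r u] is the number of k-th roots of [u], but only its support matters. *)
pose r u := \sum_(i < t.+1) chi u ^+ i.
have rP u : r u != 0 -> exists x, x ^+ t.+1 = u.
  have [->|u0] := eqVneq u 0; first by exists 0; rewrite expr0n.
  have [/chiK|chiu] := eqVneq (chi u) 1; first by move=> h _; apply: h.
  have /eqP := subrX1 (chi u) t.+1.
  rewrite chik // subrr eq_sym mulf_eq0 subr_eq0 (negPf chiu) /= => /eqP.
  by rewrite /r => ->; rewrite eqxx.
suff [u /rP[x <-] /rP[y yE]] : exists2 u, r u != 0 & r (b - u) != 0.
  by exists x, y; rewrite yE addrC subrK.
suff : \sum_u r u * r (b - u) != 0.
  move=> S0; case: (pickP (fun u => r u * r (b - u) != 0)) => [u|all0].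
    by rewrite mulf_eq0 negb_or => /andP[]; exists u.
  case/eqP: S0; apply: big1 => u _; apply/eqP; exact: negbFE (all0 u).
pose J i j := jacobi (fun x => chi x ^+ i) (fun x => chi x ^+ j).
have J00 : J 0%N 0%N = #|F|%:R.
  by rewrite /J /jacobi; under eq_bigr do rewrite mulr1; rewrite sumr_const.
have JS0 (i : 'I_t) : J (lift ord0 i) 0%N = 0.
  rewrite /J /jacobi; under eq_bigr do rewrite mulr1.
  by rewrite sum_mul_char ?lift0 //; [exact: mul_charX | apply: chiN; rewrite /= ltnS].
have J0S (i : 'I_t) : J 0%N (lift ord0 i) = 0.
  rewrite /J /jacobi; under eq_bigr do rewrite mul1r.
  have inj1 : injective (fun x : F => 1 - x) by move=> x y /addrI /oppr_inj.
  rewrite -(reindex_inj inj1 (P := predT) (F := fun x => chi x ^+ _)) /=.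
  by rewrite sum_mul_char ?lift0 //; [exact: mul_charX | apply: chiN; rewrite /= ltnS].
have -> : \sum_u r u * r (b - u)
   = \sum_(i < t.+1) \sum_(j < t.+1) chi b ^+ (i + j) * J i j.
  under eq_bigr => u _ do rewrite mulr_suml.
  rewrite exchange_big; apply: eq_bigr => i _ /=.
  under eq_bigr => u _ do rewrite mulr_sumr.
  rewrite exchange_big; apply: eq_bigr => j _ /=.
  (* [u = b * v] makes both arguments multiples of [b]. *)
  rewrite (reindex_inj (mulfI b0)) mulr_sumr; apply: eq_bigr => v _ /=.
  by rewrite -{2}[b]mulr1 -mulrBr !chiM !exprMn exprD; ring.
rewrite big_ord_recl big_ord_recl /= J00 add0n expr0 mul1r.
rewrite big1 => [|j _]; last by rewrite J0S mulr0.
rewrite addr0; under eq_bigr => i _ do rewrite big_ord_recl JS0 mulr0 add0r.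
set T := \sum_(i < t) _.
suff leT : `|T| <= t%:R * (1 + t.-1%:R * sqrtC #|F|%:R).
  have q1 := finNzRing_gt1 F.
  apply/eqP => h; have := le_lt_trans leT (jacobi_bound_lt q1 tq).
  have -> : T = - #|F|%:R.
    by apply/eqP; rewrite -addr_eq0 addrC; apply/eqP.
  by rewrite normrN normr_nat ltxx.
apply: (le_trans (ler_norm_sum _ _ _)).
rewrite -[t in t%:R](card_ord t) -sumr_const mulr_suml; apply: ler_sum => i _.
apply: (le_trans (ler_norm_sum _ _ _)).
have chib : `|chi b| = 1 by apply: mul_char_norm.
(* In each row there is exactly one exponent opposite to the given one. *)
have JE j : `|chi b ^+ (lift ord0 i + lift ord0 j) * J (lift ord0 i) (lift ord0 j)|
   = if j == rev_ord i then 1 else sqrtC #|F|%:R.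
  rewrite normrM normrX chib expr1n mul1r (norm_jacobi chiP chiN chik) ?lift0 ?ltnS //=.
  congr (if _ then _ else _); apply/eqP/eqP => [h|->].
    have ij : (i.+1 + j = t)%N by apply: succn_inj; rewrite -addnS.
    by apply: val_inj; rewrite /= -(addKn i.+1 j) ij.
  by rewrite /= addnS subnKC.
under eq_bigr do rewrite JE.
rewrite (bigD1 (rev_ord i)) //= eqxx mul1r lerD2l.
rewrite (eq_bigr (fun=> sqrtC #|F|%:R)) => [|j /negPf-> //].
by rewrite sumr_const cardC1 card_ord mulr_natl.
Qed.

Lemma prim_root_half (F : finFieldType) (z : F) :
  (#|F| - 1).-primitive_root z -> odd #|F| ->
  z ^+ ((#|F| - 1) %/ 2) = -1 /\ -1 != 1 :> F.
Proof.
move=> zP odq; have q1 := finNzRing_gt1 F.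
have n2 : (2 %| #|F| - 1)%N by rewrite dvdn2 oddB ?(ltnW q1) //= addbT odq.
have h1 : z ^+ ((#|F| - 1) %/ 2) != 1.
  rewrite -(prim_order_dvd zP) gtnNdvd //.
    by rewrite divn_gt0 // dvdn_leq // subn_gt0.
  by rewrite ltn_Pdiv // subn_gt0.
suff hE : z ^+ ((#|F| - 1) %/ 2) = -1 by rewrite -{2}hE.
have /eqP : (z ^+ ((#|F| - 1) %/ 2)) ^+ 2 = 1.
  by rewrite -exprM divnK // prim_expr_order.
by rewrite sqrf_eq1 (negPf h1) => /eqP.
Qed.

(** Half of the full order of a generator gives [-1], so [-1] is a k-th power
    when [k] divides [(q - 1) / 2].  Conversely [w ^+ k = -1] forces
    [(-1) ^+ ((q - 1) / k) = 1], hence an even exponent when [-1 != 1]. *)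
Lemma neg1_power (F : finFieldType) (k : nat) :
  (k %| #|F| - 1)%N ->
  (exists w : F, w ^+ k = -1) <->
    (~~ odd #|F| \/ odd #|F| /\ (k %| (#|F| - 1) %/ 2)%N).
Proof.
move=> kq; have q1 := finNzRing_gt1 F.
have k0 : (0 < k)%N by apply: dvdn_gt0 kq; rewrite subn_gt0.
have [z zP] := finField_prim_root F.
split=> [[w wk]|[ev|[odq kh]]].
- case odq: (odd _); [right; split=> // | by left].
  have [_ N1] := prim_root_half zP odq.
  have w0 : w != 0.
    apply: contraTneq (oner_neq0 F) => w0.
    by rewrite -oppr_eq0 -wk w0 expr0n eqn0Ngt k0 eqxx.
  have := fin_expf_card_pred w0.
  rewrite -(divnK kq) mulnC exprM wk -signr_odd.
  have [_ /eqP|e _] := boolP (odd _); first by rewrite expr1 (negPf N1).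
  have /dvdnP[c ->] : (2 %| (#|F| - 1) %/ k)%N by rewrite dvdn2 e.
  by rewrite mulnA mulnK // dvdn_mulr.
- exists 1; rewrite expr1n; have := expf_card (-1 : F).
  by rewrite -signr_odd (negPf ev) expr0.
- exists (z ^+ ((#|F| - 1) %/ 2 %/ k)); rewrite -exprM divnK //.
  by case: (prim_root_half zP odq).
Qed.

(** * Finite local rings *)

(** Ideals as finite sets, the unit ideal included, so that maximal ones for a
    given property can be extracted from the finite type of subsets. *)
Definition ideal_set (R : finComNzRingType) (A : {set R}) : bool :=
  (0 \in A) && [forall a : R, forall u in A, forall v in A, a * u + v \in A].

Lemma ideal_setP (R : finComNzRingType) (A : {set R}) :
  reflect (0 \in A /\ forall a, {in A &, forall u v, a * u + v \in A})
          (ideal_set A).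
Proof.
apply: (iffP andP) => -[A0 Acl]; split => //.
  move=> a u v uA vA; move/forallP/(_ a)/forall_inP/(_ u uA) : Acl.
  by move/forall_inP; apply.
apply/forallP => a; apply/forall_inP => u uA; apply/forall_inP => v vA.
exact: Acl.
Qed.

Lemma ideal_set0 (R : finComNzRingType) : ideal_set [set 0 : R].
Proof.
apply/ideal_setP; split; rewrite ?inE // => a u v /set1P -> /set1P ->.
by rewrite mulr0 addr0 inE.
Qed.

Definition adjoin (R : finComNzRingType) (A : {set R}) (w : R) : {set R} :=
  [set a * w + v | a : R, v : R in A].

Lemma adjoinP (R : finComNzRingType) (A : {set R}) (w : R) :
  ideal_set A ->
  [/\ ideal_set (adjoin A w), A \subset adjoin A w & w \in adjoin A w].
Proof.
case/ideal_setP => A0 Acl; split.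
- apply/ideal_setP; split.
    by apply/imset2P; exists 0 0; rewrite // mul0r addr0.
  move=> a _ _ /imset2P[b u _ uA ->] /imset2P[c v _ vA ->].
  apply/imset2P; exists (a * b + c) (a * u + v); rewrite ?inE ?Acl //.
  by ring.
- apply/subsetP => v vA; apply/imset2P; exists 0 v; rewrite ?inE //.
  by rewrite mul0r add0r.
- by apply/imset2P; exists 1 0; rewrite ?inE // mul1r addr0.
Qed.

(** The ideal generated by a non-unit [x] is proper, and a largest proper ideal
    above it is maximal, hence equal to [m] by locality. *)
Lemma local_ring_unit (R : finComNzRingType) (m : idealr R) (x : R) :
  local_ring m -> x \notin m -> exists y, x * y = 1.
Proof.
case=> _ mU xm; case: (pickP (fun y => x * y == 1)) => [y /eqP|nu].
  by exists y.
have zI := ideal_set0 R.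
have [xI _ xin] := adjoinP x zI.
pose P (A : {set R}) := [&& ideal_set A, 1 \notin A & x \in A].
have /maxset_exists[A /maxsetP[/and3P[AI A1 xA] Amax] _] : P (adjoin [set 0] x).
  rewrite /P xI xin andbT; apply/imset2P => -[a v _ /set1P -> /esym/eqP].
  by rewrite addr0 mulrC nu.
have [A0 Acl] := ideal_setP A AI.
have JP : idealr_closed (fun y => y \in A) by [].
pose J : idealr R := HB.pack_for (idealr R) (fun y => y \in A)
   (isIdealr.Build R (fun y => y \in A) JP).
case/negP: xm; rewrite -(mU J) // => J' sub y.
have := Amax [set y in J'] => /(_ _ _)/setP /(_ y); rewrite inE; apply.
  apply/and3P; split; last 1 first.
  - by rewrite inE; apply: sub.
  - apply/ideal_setP; split; first by rewrite inE idealr0.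
    by move=> a u v; rewrite !inE => uJ vJ; rewrite rpredD // idealMr.
  - by rewrite inE idealr1.
by apply/subsetP => z zA; rewrite inE; apply: sub.
Qed.

(** All that is used of the residue field: a surjective reduction map that
    reflects units. *)
Definition local_onto (R : finComNzRingType) (F : finFieldType)
    (f : {rmorphism R -> F}) : Prop :=
  (forall b, exists a, f a = b) /\ (forall x, f x != 0 -> exists y, x * y = 1).

Lemma residue_map (R : finComNzRingType) (m : idealr R) (F : finFieldType)
    (res : {rmorphism {ideal_quot m} -> F}) :
  local_ring m -> bijective res -> exists f : {rmorphism R -> F}, local_onto f.
Proof.
move=> mL [g resK gK].
exists (res \o \pi_({ideal_quot m})%qT); split=> [b|x fx].
  by exists (repr (g b)); rewrite /= reprK gK.
apply: (local_ring_unit mL); apply: contra fx => xm /=.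
have := Quotient.idealrBE m x 0; rewrite subr0 xm => /esym/eqP ->.
by rewrite rmorph0 rmorph0.
Qed.

(** Hensel's lemma by counting.  On the coset of [a] modulo the kernel, the
    k-th power map is injective: [x ^+ k - y ^+ k] is [x - y] times a sum that
    reduces to [k * a ^+ (k - 1)], a unit.  Its image lies in the coset of
    [a ^+ k], which has the same cardinal, so it is the whole coset. *)
Lemma hensel_power (R : finComNzRingType) (F : finFieldType)
    (f : {rmorphism R -> F}) (k : nat) (a u : R) :
  local_onto f -> k%:R != 0 :> F -> f a != 0 -> f u = f a ^+ k ->
  exists x, x ^+ k = u.
Proof.
move=> [_ funit] k0 a0 fu.
pose D := [set x | f x == f a]; pose E := [set x | f x == f a ^+ k].
suff imE : [set x ^+ k | x in D] = E.
  have : u \in E by rewrite inE fu.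
  by rewrite -imE => /imsetP[x _ ->]; exists x.
have DE : #|E| = #|D|.
  have inj : injective (fun x => x + (a ^+ k - a)) by exact: addIr.
  rewrite -(card_imset (mem D) inj); apply: eq_card => y.
  rewrite inE; apply/eqP/imsetP => [fy|[x]].
    exists (y - (a ^+ k - a)); last by rewrite subrK.
    by rewrite inE !rmorphB /= rmorphXn /= fy; apply/eqP; ring.
  by rewrite inE => /eqP fx ->; rewrite rmorphD rmorphB /= fx rmorphXn /=; ring.
apply/eqP; rewrite eqEcard DE; apply/andP; split.
  apply/subsetP => _ /imsetP[x + ->]; rewrite !inE => /eqP fx.
  by rewrite rmorphXn /= fx.
rewrite card_in_imset // => x y; rewrite !inE => /eqP fx /eqP fy /eqP.
rewrite -subr_eq0 subrXX => /eqP xy; apply/eqP; rewrite -subr_eq0; apply/eqP.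
set S := \sum_(i < k) _ in xy.
have [|v Sv] := funit S; last by rewrite -[LHS]mulr1 -Sv mulrA xy mul0r.
have -> : f S = k%:R * f a ^+ k.-1.
  rewrite rmorph_sum (eq_bigr (fun=> f a ^+ k.-1)) => [|i _].
    by rewrite sumr_const card_ord mulr_natl.
  rewrite rmorphM !rmorphXn /= fx fy -exprD; congr (_ ^+ _).
  by case: (k) i => [[]//|k' i] /=; rewrite subnK // -ltnS.
by rewrite mulf_neq0 // expf_neq0.
Qed.

(** Take [A] maximal among the ideals strictly contained in the kernel of [f].
    If [x * y] were outside [A], adjoining it to [A] would give the whole
    kernel, so [y = a * x * y + v] with [v] in [A]; as [1 - a * x] is a unit,
    [y] and then [x * y] would be in [A].  This replaces Nakayama's lemma. *)
Lemma exists_irreducible_nonunit (R : finComNzRingType) (F : finFieldType)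
    (f : {rmorphism R -> F}) (x0 : R) :
  local_onto f -> x0 != 0 -> f x0 = 0 ->
  exists A : {set R}, [/\ ideal_set A,
    forall x y, f x = 0 -> f y = 0 -> x * y \in A &
    exists2 r, f r = 0 & r \notin A].
Proof.
move=> [_ funit] x00 fx0; pose K := [set x | f x == 0].
have zI := ideal_set0 R.
have KI : ideal_set K.
  apply/ideal_setP; split; rewrite ?inE ?rmorph0 // => a u v.
  by rewrite !inE rmorphD rmorphM /= => /eqP -> /eqP ->; rewrite mulr0 addr0.
pose P (A : {set R}) := ideal_set A && (A \proper K).
have /maxset_exists[A /maxsetP[/andP[AI AK] Amax] _] : P [set 0].
  rewrite /P zI /= properE sub1set inE rmorph0 eqxx /=.
  by apply/subsetPn; exists x0; rewrite !inE ?fx0 // negbT // (negPf x00).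
have [A0 Acl] := ideal_setP A AI.
exists A; split=> //; last first.
  have /andP[_ /subsetPn[r]] := AK.
  by rewrite inE => /eqP fr rA; exists r.
move=> x y fx fy; apply: contraT => xyA.
have [BI AB xyB] := adjoinP (x * y) AI; set B := adjoin A _ in BI AB xyB.
have BK : B \subset K.
  apply/subsetP => _ /imset2P[a v _ /(subsetP (proper_sub AK)) + ->].
  by rewrite !inE rmorphD !rmorphM /= fx => /eqP ->; rewrite mul0r mulr0 addr0.
have yB : y \in B.
  apply: contraT => yB; case/negP: xyA; rewrite -(Amax B) // /P BI properE BK.
  by apply/subsetPn; exists y => //; rewrite inE fy.
case/imset2P: yB => a v _ vA yE.
have [|w uw] := funit (1 - a * x).
  by rewrite rmorphB rmorphM /= fx mulr0 subr0 rmorph1 oner_eq0.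
have yA : y \in A.
  have -> : y = w * v + 0.
    rewrite addr0 -[LHS]mul1r -uw.
    have -> : v = y - a * (x * y) by rewrite {1}yE addrC addKr.
    by ring.
  exact: Acl.
by case/negP: xyA; rewrite -[x * y]addr0 Acl.
Qed.

(** * Waring numbers of finite local rings *)

Lemma sums_of_powers_coverW (R : comNzRingType) (k s t : nat) :
  (0 < k)%N -> (s <= t)%N ->
  sums_of_powers_cover R k s -> sums_of_powers_cover R k t.
Proof.
move=> k0 /subnKC <- cov r; have [x <-] := cov r.
exists [ffun i => if split i is inl j then x j else 0].
rewrite big_split_ord /= [X in _ + X]big1 => [|i _].
  by rewrite addr0; apply: eq_bigr => i _; rewrite ffunE (unsplitK (inl i)).
by rewrite ffunE (unsplitK (inr i)) expr0n eqn0Ngt k0.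
Qed.

Lemma sums_of_powers_cover2 (R : comNzRingType) (k : nat) :
  sums_of_powers_cover R k 2 <-> forall r : R, exists x y, x ^+ k + y ^+ k = r.
Proof.
split=> cov r; have := cov r.
  by case=> x; rewrite big_ord_recl big_ord1; exists (x ord0), (x (lift ord0 ord0)).
case=> x [y xy]; exists [ffun i => if i == ord0 then x else y].
by rewrite big_ord_recl big_ord1 !ffunE.
Qed.

Lemma waringP (R : comNzRingType) (k g : nat) :
  (0 < k)%N -> sums_of_powers_cover R k g.+1 ->
  ~ sums_of_powers_cover R k g -> waring R k g.+1.
Proof.
move=> k0 cov ncov; split=> // s covs; rewrite ltnNge; apply/negP => sg.
exact/ncov/(sums_of_powers_coverW k0 sg).
Qed.

(** At least one of the two powers found in [F] has a nonzero base; after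
    lifting the other one arbitrarily, the difference lifts by [hensel_power]. *)
Lemma sum_two_powers_unit (R : finComNzRingType) (F : finFieldType)
    (f : {rmorphism R -> F}) (k : nat) :
  local_onto f -> k%:R != 0 :> F ->
  (forall b : F, b != 0 -> exists x y, x ^+ k + y ^+ k = b) ->
  forall r : R, f r != 0 -> exists x y, x ^+ k + y ^+ k = r.
Proof.
move=> fL k0 covF r fr; have [fsurj _] := fL.
have [a [b ab]] := covF _ fr.
wlog a0 : a b ab / a != 0 => [hw|].
  have [aE|] := eqVneq a 0; last exact: hw ab.
  apply: (hw b a); first by rewrite addrC.
  apply: contraNneq fr => b0; rewrite -ab aE b0 expr0n.
  case: (k) k0 => [|k' _] /=; [by rewrite eqxx | by rewrite addr0].
have [A fA] := fsurj a; have [B fB] := fsurj b.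
have [||x xE] := @hensel_power _ _ f k A (r - B ^+ k) fL k0.
- by rewrite fA.
- by rewrite rmorphB rmorphXn /= fA fB -ab addrK.
by exists x, B; rewrite xE subrK.
Qed.

Lemma power_nonunit (R : finComNzRingType) (F : finFieldType)
    (f : {rmorphism R -> F}) (k : nat) (x : R) : (0 < k)%N -> f (x ^+ k) = 0 -> f x = 0.
Proof.
by move=> k0 /eqP; rewrite rmorphXn expf_eq0 k0 /= => /eqP.
Qed.

(** The number of powers that nonunits require, two or three, is decided by
    whether [-1] is a k-th power in the residue field. *)
Lemma waring_local (R : finComNzRingType) (F : finFieldType)
    (f : {rmorphism R -> F}) (k : nat)
    (x0 : R) :
  local_onto f -> x0 != 0 -> f x0 = 0 -> (1 < k)%N -> k%:R != 0 :> F ->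
  (forall b : F, b != 0 -> exists x y, x ^+ k + y ^+ k = b) ->
  ((exists w : F, w ^+ k = -1) -> waring R k 2) /\
  (~ (exists w : F, w ^+ k = -1) -> waring R k 3).
Proof.
move=> fL x00 fx0 k1 k0 covF; have [fsurj _] := fL.
have kpos : (0 < k)%N by exact: ltnW.
have covU := sum_two_powers_unit fL k0 covF.
have [A [/ideal_setP[A0 Acl] Asq [r0 fr0 r0A]]] := exists_irreducible_nonunit fL x00 fx0.
have powA x : f x = 0 -> x ^+ k \in A.
  case: (k) k1 => [|[|k']] // _ fx; rewrite exprS Asq // exprS rmorphM /= fx.
  by rewrite mul0r.
split=> [[w wk]|nw]; apply: waringP => //.
- apply/sums_of_powers_cover2 => r; have [fr|] := eqVneq (f r) 0; last exact: covU.
  have [W fW] := fsurj w.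
  have w0 : w != 0.
    apply: contraTneq (oner_neq0 F) => w0.
    by rewrite -oppr_eq0 -wk w0 expr0n eqn0Ngt kpos eqxx.
  have [||x xE] := @hensel_power _ _ f k W (r - 1) fL k0.
  + by rewrite fW.
  + by rewrite rmorphB rmorph1 fr fW wk sub0r.
  by exists x, 1; rewrite xE expr1n subrK.
- move=> cov1; have [x] := cov1 r0; rewrite big_ord1 => xE.
  by case/negP: r0A; rewrite -xE powA // (@power_nonunit _ _ f k _ kpos) // xE.
- move=> r; have [fr|fr] := eqVneq (f r) 0.
    have [|x [y xy]] := covU (r - 1).
      by rewrite rmorphB rmorph1 fr sub0r oppr_eq0 oner_eq0.
    exists [ffun i : 'I_3 => if i == 0 then 1 else if i == 1 then x else y].
    rewrite !big_ord_recl big_ord0 !ffunE /= addr0 xy expr1n; ring.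
  have [x [y xy]] := covU r fr.
  exists [ffun i : 'I_3 => if i == 0 then 0 else if i == 1 then x else y].
  by rewrite !big_ord_recl big_ord0 !ffunE /= addr0 xy expr0n eqn0Ngt kpos add0r.
- move=> /sums_of_powers_cover2 cov2; have [x [y xy]] := cov2 r0.
  have fxy : f x ^+ k + f y ^+ k = 0 by rewrite -!rmorphXn -rmorphD xy.
  have fy : f y = 0.
    apply/eqP/negPn/negP => fy; apply: nw; exists (f x / f y).
    rewrite expr_div_n -[f x ^+ k]subr0 -fxy opprD addrA subrr sub0r mulNr.
    by rewrite divff // expf_neq0.
  have fx : f x = 0.
    apply/eqP; move/eqP: fxy; rewrite fy expr0n eqn0Ngt kpos addr0.
    by rewrite expf_eq0 kpos.
  by case/negP: r0A; rewrite -xy -[x ^+ k]mul1r Acl ?powA.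
Qed.

(** That [R] is not a field provides the nonzero nonunit on which the lower
    bounds rest. *)
Lemma waring_of_bound (R : finComNzRingType) (m : idealr R) (F : finFieldType)
    (res : {rmorphism {ideal_quot m} -> F}) (k p : nat) :
  local_ring m -> ~ is_field_ring R -> bijective res ->
  prime p -> p \in [pchar F] -> coprime k p ->
  (1 < k)%N -> (k %| #|F| - 1)%N -> (k.-1 ^ 4 <= #|F|)%N ->
  (~~ odd #|F| \/ odd #|F| /\ (k %| (#|F| - 1) %/ 2)%N -> waring R k 2) /\
  (odd #|F| /\ ~ (k %| (#|F| - 1) %/ 2)%N -> waring R k 3).
Proof.
move=> mL nfield resb pp charF kp k1 kq kF.
have [f fL] := residue_map mL resb.
have [x0 x00 fx0] : exists2 x0 : R, x0 != 0 & f x0 = 0.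
  case: (pickP (fun x : R => (x != 0) && (f x == 0))) => [x /andP[x0 /eqP fx]|nx].
    by exists x.
  case: nfield => x x0; case: fL => _; apply.
  by have := nx x; rewrite /= x0 /= => ->.
have k0 : k%:R != 0 :> F.
  by rewrite -(dvdn_pcharf charF) -prime_coprime // coprime_sym.
have [w2 w3] := waring_local fL x00 fx0 k1 k0
  (fun b => sum_two_powers (ltnW k1) kq kF).
have Npow := neg1_power kq.
split=> [/Npow /w2 //|[odq kn]].
by apply: w3 => /Npow[|[]//]; rewrite odq.
Qed.

Local Close Scope ring_scope.

Theorem proposition7p2
  (R : finComNzRingType) (m : idealr R)
  (Rlocal : local_ring m) (Rnonfield : ~ is_field_ring R)
  (F : finFieldType) (res : {rmorphism {ideal_quot m} -> F})
  (res_bij : bijective res)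
  (p d q : nat) (p_prime : prime p) (charF : (p \in [pchar F])%R)
  (cardF : #|F| = q) (q_pd : q = p ^ d) :
  (forall k : nat,
     coprime k p -> k %| q - 1 -> dagger ((q - 1) %/ k) p d ->
     2 <= k -> (k%:R <= 4.-root (q%:R : algC) + 1 :> algC)%R ->
     (~~ odd q \/ (odd q /\ k %| (q - 1) %/ 2) -> waring R k 2) /\
     (odd q /\ ~ (k %| (q - 1) %/ 2) -> waring R k 3)) /\
  (coprime 2 p -> 2 %| q - 1 ->
     (q = 1 %[mod 4] -> waring R 2 2) /\
     (q = 3 %[mod 4] -> waring R 2 3)) /\
  (forall r : nat, 2 <= r -> 2 ^ (4 * r) <= q ->
     coprime (2 ^ r) p -> 2 ^ r %| q - 1 ->
     (q = 1 %[mod 2 ^ r.+1] -> waring R (2 ^ r) 2) /\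
     (q <> 1 %[mod 2 ^ r.+1] -> waring R (2 ^ r) 3)).
Proof.
have q1 : 1 < q by rewrite -cardF finNzRing_gt1.
have main := waring_of_bound Rlocal Rnonfield res_bij p_prime charF.
rewrite cardF in main.
have odd_of k : 2 %| k -> k %| q - 1 -> odd q.
  move=> k2 kq; have := dvdn_trans k2 kq.
  by rewrite dvdn2 oddB ?(ltnW q1) // addbT negbK.
(* The condition that decides between two and three, as a congruence. *)
have half k : 0 < k -> odd q -> (k %| (q - 1) %/ 2) = (q == 1 %[mod 2 * k]).
  move=> k0 odq; rewrite eqn_mod_dvd ?(ltnW q1) // dvdn_divRL ?[2 * k]mulnC //.
  by rewrite dvdn2 oddB ?(ltnW q1) //= addbT odq.
split=> [k kp kq _ k2 kroot|].
  apply: main => //; rewrite -(ler_nat algC) natrX.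
  rewrite -[X in (_ <= X)%R](rootCK (n := 4)) // ler_pXn2r ?nnegrE ?ler0n //.
    by rewrite -subn1 natrB ?(ltnW k2) // lerBlDr.
  by rewrite rootC_ge0 // ler0n.
split=> [c2p q2|r r2 qr crp rq].
  have odq : odd q by apply: odd_of q2.
  have [w2 w3] := main 2 c2p isT q2 (ltnW q1).
  rewrite (half 2) // in w2 w3.
  split=> qE; [apply: w2; right | apply: w3]; split=> //; first exact/eqP.
  by rewrite qE.
have odq : odd q by apply: odd_of rq; rewrite dvdn_exp // ltnW.
have r1 : 1 < 2 ^ r by rewrite -{1}(expn0 2) ltn_exp2l // ltnW.
have rF : (2 ^ r).-1 ^ 4 <= q.
  by apply: leq_trans qr; rewrite mulnC expnM leq_exp2r // leq_pred.
have [w2 w3] := main (2 ^ r) crp r1 rq rF.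
rewrite (half (2 ^ r)) ?expn_gt0 // -expnS in w2 w3.
split=> qE; [apply: w2; right | apply: w3]; split=> //; first exact/eqP.
by move/eqP.
Qed.
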